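(* Let $\eta\in(0,1)$, $k>0$, $|\theta|<\pi/2$, $\kappa=k\sin\theta$, $\zeta=k\cos\theta$, $I_0\in\mathbb{C}$, and let $$\bar\tau=\begin{bmatrix} \infty & 0 \\ 0 & 1/\eta \end{bmatrix},\qquad\bar\mu=\eta .$$ If the incident wave is $u^i=I_0e^{i(\kappa x_1-\zeta(x_2-1))}$, then the total field of the layered-medium scattering problem $\nabla\cdot(\frac1\tau\nabla u)+k^2\mu u=0$ has the form $$u(x_1,x_2)=\begin{cases} I_0e^{i(\kappa x_1-\zeta(x_2-1))}+R_0e^{i(\kappa x_1+\zeta(x_2-1))}, & x_2>1, \\ T_0e^{i(\kappa x_1-\zeta x_2)}, & x_2<0, \end{cases}$$ with $$R_0=\frac{i(-\zeta^2+\eta^2k^2)\tan k}{-i(\zeta^2+\eta^2k^2)\tan k+2\zeta\eta k}\,I_0,\qquad T_0=\frac{2\zeta\eta k}{-i(\zeta^2+\eta^2k^2)\sin k+2\zeta\eta k\cos k}\,I_0 .$$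
   Context: The medium: $\tau=1,\mu=1$ for $x_2>1$ or $x_2<0$, and $\tau=\bar\tau$, $\mu=\bar\mu$ for $0<x_2<1$. The entry $\infty$ means that $1/\tau=\mathrm{diag}(0,\eta)$ in the layer, so that the equation there reads $\eta\,\partial_{x_2}^2u+k^2\eta\,u=0$. Across the interfaces $x_2=0$ and $x_2=1$ one imposes continuity of $u$ and of the flux: $u(x_1,0-)=u(x_1,0+)$, $\partial_{x_2}u(x_1,0-)=\eta\,\partial_{x_2}u(x_1,0+)$, $u(x_1,1-)=u(x_1,1+)$, $\eta\,\partial_{x_2}u(x_1,1-)=\partial_{x_2}u(x_1,1+)$. The solution sought has $x_1$-dependence $e^{i\kappa x_1}$, and $u-u^i$ is outgoing for $x_2>1$ while $u$ is outgoing for $x_2<0$ (i.e. proportional to $e^{i(\kappa x_1+\zeta(x_2-1))}$ and $e^{i(\kappa x_1-\zeta x_2)}$ respectively). When $\cos k=0$ the formula for $R_0$ is read after multiplying numerator and denominator by $\cos k$. *)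

(* Defs.v *)
From Stdlib Require Export Reals.
From Coquelicot Require Export Coquelicot.

Local Open Scope R_scope.

(** e^{it} for real t. *)
Definition expi (t : R) : C := (cos t, sin t).

(** Calculus of functions R -> C of a real variable.  The value [CDerive] is
    only meaningful under [Cex_derive]. *)
Definition Cex_derive (f : R -> C) (x : R) : Prop :=
  @ex_derive R_AbsRing C_R_NormedModule f x.

Definition CDerive (f : R -> C) (x : R) : C :=
  (Derive (fun t => fst (f t)) x, Derive (fun t => snd (f t)) x).

Definition partial1 (u : R -> R -> C) (x1 x2 : R) : C := CDerive (fun s => u s x2) x1.
Definition partial2 (u : R -> R -> C) (x1 x2 : R) : C := CDerive (fun s => u x1 s) x2.

(** f(a-) = g(a+), both one-sided limits existing in C. *)
Definition match_at (a : R) (f g : R -> C) : Prop :=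
  exists l : C, filterlim f (at_left a) (locally l) /\
                filterlim g (at_right a) (locally l).

(** Tensor coefficients are matrices with entries in the extended reals, with
    rows and columns numbered from 0. *)
Definition diag2 {T : Type} (o a b : T) : @matrix T 2 2 :=
  mk_matrix 2 2 (fun i j =>
    match i, j with 0%nat, 0%nat => a | 1%nat, 1%nat => b | _, _ => o end).

Definition tau_bar (eta : R) : @matrix Rbar 2 2 :=
  diag2 (Finite 0) p_infty (Finite (1 / eta)).

Definition mu_bar (eta : R) : R := eta.

Definition in_layer (x2 : R) : bool :=
  if Rlt_dec 0 x2 then (if Rlt_dec x2 1 then true else false) else false.

(** On the interfaces x2 = 0 and x2 = 1 the values of the coefficients are
    immaterial: the equation is only imposed off them. *)
Definition tau (eta x2 : R) : @matrix Rbar 2 2 :=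
  if in_layer x2 then tau_bar eta else diag2 (Finite 0) (Finite 1) (Finite 1).

Definition mu (eta x2 : R) : R := if in_layer x2 then mu_bar eta else 1.

(** Inverse of a diagonal tensor; [Rbar_inv p_infty = 0], so an infinite entry
    of [tau] gives a zero entry of 1/tau. *)
Definition inv_diag (t : @matrix Rbar 2 2) : @matrix R 2 2 :=
  diag2 0 (Rbar_inv (coeff_mat (Finite 0) t 0 0))
          (Rbar_inv (coeff_mat (Finite 0) t 1 1)).

(** Component i of (1/tau) grad u. *)
Definition flux (eta : R) (u : R -> R -> C) (i : nat) (x1 x2 : R) : C :=
  let A := inv_diag (tau eta x2) in
  (RtoC (coeff_mat 0%R A i 0) * partial1 u x1 x2
   + RtoC (coeff_mat 0%R A i 1) * partial2 u x1 x2)%C.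

(** div((1/tau) grad u) + k^2 mu u = 0 at (x1, x2), in the classical sense. *)
Definition solves_at (eta k : R) (u : R -> R -> C) (x1 x2 : R) : Prop :=
  Cex_derive (fun s => u s x2) x1 /\
  Cex_derive (fun s => u x1 s) x2 /\
  Cex_derive (fun s => flux eta u 0 s x2) x1 /\
  Cex_derive (fun s => flux eta u 1 x1 s) x2 /\
  (partial1 (flux eta u 0) x1 x2 + partial2 (flux eta u 1) x1 x2
   + RtoC (k ^ 2 * mu eta x2) * u x1 x2 = 0)%C.

Definition incident (kappa zeta : R) (I0 : C) (x1 x2 : R) : C :=
  (I0 * expi (kappa * x1 - zeta * (x2 - 1)))%C.

Record total_field (eta k kappa zeta : R) (ui u : R -> R -> C) : Prop := {
  tf_equation : forall x1 x2, x2 <> 0 -> x2 <> 1 -> solves_at eta k u x1 x2;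
  tf_u0 : forall x1, match_at 0 (fun s => u x1 s) (fun s => u x1 s);
  tf_flux0 : forall x1,
    match_at 0 (fun s => partial2 u x1 s) (fun s => (RtoC eta * partial2 u x1 s)%C);
  tf_u1 : forall x1, match_at 1 (fun s => u x1 s) (fun s => u x1 s);
  tf_flux1 : forall x1,
    match_at 1 (fun s => (RtoC eta * partial2 u x1 s)%C) (fun s => partial2 u x1 s);
  tf_x1_dependence : exists phi : R -> C,
    forall x1 x2, u x1 x2 = (expi (kappa * x1) * phi x2)%C;
  tf_outgoing_above : exists c : C, forall x1 x2, 1 < x2 ->
    (u x1 x2 - ui x1 x2 = c * expi (kappa * x1 + zeta * (x2 - 1)))%C;
  tf_outgoing_below : exists c : C, forall x1 x2, x2 < 0 ->
    u x1 x2 = (c * expi (kappa * x1 - zeta * x2))%C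
}.

(** The formula with tan k, read when cos k = 0 after multiplying numerator and
    denominator by cos k. *)
Definition refl_amp (eta k zeta : R) (I0 : C) : C :=
  if Req_EM_T (cos k) 0 then
    (Ci * RtoC (- zeta ^ 2 + eta ^ 2 * k ^ 2) * RtoC (sin k)
     / (- Ci * RtoC (zeta ^ 2 + eta ^ 2 * k ^ 2) * RtoC (sin k)
        + RtoC (2 * zeta * eta * k * cos k)) * I0)%C
  else
    (Ci * RtoC (- zeta ^ 2 + eta ^ 2 * k ^ 2) * RtoC (tan k)
     / (- Ci * RtoC (zeta ^ 2 + eta ^ 2 * k ^ 2) * RtoC (tan k)
        + RtoC (2 * zeta * eta * k)) * I0)%C.

Definition trans_amp (eta k zeta : R) (I0 : C) : C :=
  (RtoC (2 * zeta * eta * k)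
   / (- Ci * RtoC (zeta ^ 2 + eta ^ 2 * k ^ 2) * RtoC (sin k)
      + RtoC (2 * zeta * eta * k * cos k)) * I0)%C.

(* Main.v *)
Require Import Defs.
From Stdlib Require Import Reals.
From Coquelicot Require Import Coquelicot.
From Stdlib Require Import Lra.
Local Open Scope R_scope.

(** In the layer the infinite entry of [tau] removes the [x1]-derivatives, so
    [u] solves [u'' + k^2 u = 0] in [x2] alone, whatever [kappa] is.  The Cauchy
    data [(k eta u, eta u')] at [0+] and [1-] are therefore related by a rotation
    of angle [k], and the four interface conditions become a 2x2 linear system
    for [R_0] and [T_0], whose determinant does not vanish since [zeta > 0]. *)

(** * Derivatives and one-sided limits of complex-valued functions of a real variable *)

Definition Cis_derive (f : R -> C) (x : R) (l : C) : Prop :=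
  @is_derive R_AbsRing C_R_NormedModule f x l.

(** The two projections are linear, which gives one direction by the chain rule; the other writes
    [f] as its real part times 1 plus its imaginary part times [Ci]. Complex derivatives are thereby
    reduced to real ones. *)
Lemma Cis_derive_iff (f : R -> C) (x : R) (l : C) :
  Cis_derive f x l <->
  is_derive (fun t => fst (f t)) x (fst l) /\ is_derive (fun t => snd (f t)) x (snd l).
Proof.
split.
- intros H; split.
  + refine (filterdiff_ext_lin _ _ _
      (filterdiff_comp' f fst x _ _ H (filterdiff_linear _ is_linear_fst)) _).
    intros y; reflexivity.
  + refine (filterdiff_ext_lin _ _ _
      (filterdiff_comp' f snd x _ _ H (filterdiff_linear _ is_linear_snd)) _).
    intros y; reflexivity.
- intros [H1 H2].
  apply (is_derive_ext (V := C_R_NormedModule)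
    (fun t => plus (scal (fst (f t)) (RtoC 1)) (scal (snd (f t)) Ci))).
  + intros t; unfold plus, scal; simpl; unfold prod_plus, prod_scal; simpl.
    unfold scal, plus; simpl; unfold mult; simpl.
    destruct (f t) as [p q]; apply injective_projections; simpl; ring.
  + replace l with (plus (G := C_R_NormedModule)
      (scal (V := C_R_NormedModule) (fst l) (RtoC 1))
      (scal (V := C_R_NormedModule) (snd l) Ci)).
    * apply (is_derive_plus (V := C_R_NormedModule));
        apply (is_derive_scal_l (V := C_R_NormedModule)); assumption.
    * unfold plus, scal; simpl; unfold prod_plus, prod_scal; simpl.
      unfold scal, plus; simpl; unfold mult; simpl.
      destruct l as [p q]; apply injective_projections; simpl; ring.
Qed.

Lemma Cis_derive_CDerive (f : R -> C) (x : R) (l : C) :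
  Cis_derive f x l -> CDerive f x = l.
Proof.
intros [H1 H2]%Cis_derive_iff.
apply injective_projections; now apply is_derive_unique.
Qed.

Lemma Cex_derive_is_derive (f : R -> C) (x : R) :
  Cex_derive f x -> Cis_derive f x (CDerive f x).
Proof. intros [l H]; now rewrite (Cis_derive_CDerive _ _ _ H). Qed.

(** Differentiability is taken over the real normed module, where a complex [c] is not a scalar; the
    product is therefore differentiated coordinate by coordinate. *)
Lemma Cis_derive_mult_l (c : C) (f : R -> C) (x : R) (l : C) :
  Cis_derive f x l -> Cis_derive (fun t => (c * f t)%C) x (c * l)%C.
Proof.
intros [H1 H2]%Cis_derive_iff; apply Cis_derive_iff; split; simpl.
- apply (is_derive_minus (fun t => fst c * fst (f t)) (fun t => snd c * snd (f t)));
    now apply is_derive_scal.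
- apply (is_derive_plus (fun t => fst c * snd (f t)) (fun t => snd c * fst (f t)));
    now apply is_derive_scal.
Qed.

Lemma Cis_derive_ext_loc (f g : R -> C) (x : R) (l : C) :
  locally x (fun t => f t = g t) -> Cis_derive f x l -> Cis_derive g x l.
Proof. apply (is_derive_ext_loc (V := C_R_NormedModule)). Qed.

Lemma Cis_derive_at_left (f : R -> C) (x : R) (l : C) :
  Cis_derive f x l -> filterlim f (at_left x) (locally (f x)).
Proof.
intros H P HP; apply filter_le_within.
now apply (ex_derive_continuous (V := C_R_NormedModule)); [exists l|].
Qed.

Lemma Cis_derive_at_right (f : R -> C) (x : R) (l : C) :
  Cis_derive f x l -> filterlim f (at_right x) (locally (f x)).
Proof.
intros H P HP; apply filter_le_within.
now apply (ex_derive_continuous (V := C_R_NormedModule)); [exists l|].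
Qed.

Lemma C_filterlim_unique (F : (R -> Prop) -> Prop) (f : R -> C) (l l' : C) :
  ProperFilter F -> filterlim f F (locally l) -> filterlim f F (locally l') -> l = l'.
Proof.
intros HF; apply (filterlim_locally_unique (V := C_R_NormedModule)).
Qed.

Lemma filterlim_Cfst (F : (R -> Prop) -> Prop) (f : R -> C) (l : C) :
  filterlim f F (locally l) -> filterlim (fun t => fst (f t)) F (locally (fst l)).
Proof.
intros H; apply (filterlim_comp _ _ _ _ _ _ _ _ H).
destruct l; apply continuous_fst.
Qed.

Lemma filterlim_Csnd (F : (R -> Prop) -> Prop) (f : R -> C) (l : C) :
  filterlim f F (locally l) -> filterlim (fun t => snd (f t)) F (locally (snd l)).
Proof.
intros H; apply (filterlim_comp _ _ _ _ _ _ _ _ H).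
destruct l; apply continuous_snd.
Qed.

Lemma filterlim_Cmult_l (c : C) (F : (R -> Prop) -> Prop) (f : R -> C) (l : C) :
  filterlim f F (locally l) -> filterlim (fun t => (c * f t)%C) F (locally (c * l)%C).
Proof.
intros H; apply (filterlim_comp _ _ _ f (fun z => (c * z)%C) _ _ _ H).
apply (filterlim_scal_r (V := C_NormedModule) c l).
Qed.

Lemma Cis_derive_mult_r (f : R -> C) (c : C) (x : R) (l : C) :
  Cis_derive f x l -> Cis_derive (fun t => (f t * c)%C) x (l * c)%C.
Proof.
intros H; rewrite Cmult_comm.
apply (is_derive_ext (V := C_R_NormedModule) (fun t => (c * f t)%C)).
- intros t; apply Cmult_comm.
- now apply Cis_derive_mult_l.
Qed.

(** * Complex exponentials and trigonometric waves *)

Lemma expi_plus (s t : R) : expi (s + t) = (expi s * expi t)%C.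
Proof.
unfold expi; rewrite cos_plus, sin_plus; unfold Cmult; simpl; f_equal; ring.
Qed.

Lemma Cis_derive_expi (m t : R) :
  Cis_derive (fun s => expi (m * s)) t (Ci * RtoC m * expi (m * t))%C.
Proof.
apply Cis_derive_iff; split; simpl; (auto_derive; [easy | ring]).
Qed.

(** The general solution of [f'' + m^2 f = 0], parametrised by its Cauchy data at 0: value [a] and
    slope [m b]. It describes the plane waves outside the layer and the field inside it alike, and
    an argument [t - d] places the data at the interface [d]. *)
Definition harmonic (a b : C) (m t : R) : C :=
  (a * RtoC (cos (m * t)) + b * RtoC (sin (m * t)))%C.

Lemma Cis_derive_harmonic (a b : C) (m d t : R) :
  Cis_derive (fun s => harmonic a b m (s - d)) t
    (harmonic (RtoC m * b) (- RtoC m * a) m (t - d)).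
Proof.
apply Cis_derive_iff; split; simpl; (auto_derive; [easy | unfold Rminus; ring]).
Qed.

Lemma harmonic_0 (a b : C) (m t : R) : harmonic a b m (t - t) = a.
Proof.
unfold harmonic; rewrite Rminus_diag, Rmult_0_r, cos_0, sin_0; ring.
Qed.

Lemma expi_harmonic (m t : R) : expi (m * t) = harmonic 1 Ci m t.
Proof.
unfold expi, harmonic, Cplus, Cmult; simpl; f_equal; ring.
Qed.

Lemma expi_opp_harmonic (m t : R) : expi (- (m * t)) = harmonic 1 (- Ci) m t.
Proof.
unfold expi, harmonic, Cplus, Cmult; rewrite cos_neg, sin_neg; simpl; f_equal; ring.
Qed.

(** * Transfer of Cauchy data through the layer *)

(** On the open interval [f] is constant, equal to its value at the midpoint, and both one-sided
    limits are this constant. Limits replace endpoint values because the interface conditions speak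
    only of limits. *)
Lemma null_derive_limits_eq (f : R -> R) (a b la lb : R) :
  a < b -> (forall x, a < x < b -> is_derive f x 0) ->
  filterlim f (at_right a) (locally la) ->
  filterlim f (at_left b) (locally lb) -> la = lb.
Proof.
intros Hab Hf Ha Hb.
set (c := (a + b) / 2).
assert (Hc : forall x, a < x < b -> f x = f c).
{ intros x Hx; unfold c.
  destruct (Rtotal_order x ((a + b) / 2)) as [H | [H | H]].
  - apply (eq_is_derive f); [|exact H]; intros t Ht; apply Hf; lra.
  - now rewrite H.
  - symmetry; apply (eq_is_derive f); [|exact H]; intros t Ht; apply Hf; lra. }
transitivity (f c).
- apply (filterlim_locally_unique (F := at_right a) f); [exact Ha|].
  apply filterlim_ext_loc with (fun _ => f c); [|apply filterlim_const].
  apply (locally_interval _ a m_infty b); simpl; [easy | exact Hab |].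
  intros y _ Hy Hay; symmetry; apply Hc; lra.
- apply (filterlim_locally_unique (F := at_left b) f); [|exact Hb].
  apply filterlim_ext_loc with (fun _ => f c); [|apply filterlim_const].
  apply (locally_interval _ b a p_infty); simpl; [exact Hab | easy |].
  intros y Hy _ Hyb; symmetry; apply Hc; lra.
Qed.

(* Both [k f cos (k t) - g sin (k t)] and [k f sin (k t) + g cos (k t)] are conserved. *)
Lemma oscillator_transfer (k : R) (f g : R -> R) (f0 g0 f1 g1 : R) :
  (forall x, 0 < x < 1 -> is_derive f x (g x)) ->
  (forall x, 0 < x < 1 -> is_derive g x (- k ^ 2 * f x)) ->
  filterlim f (at_right 0) (locally f0) -> filterlim g (at_right 0) (locally g0) ->
  filterlim f (at_left 1) (locally f1) -> filterlim g (at_left 1) (locally g1) ->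
  k * f1 = k * f0 * cos k + g0 * sin k /\ g1 = g0 * cos k - k * f0 * sin k.
Proof.
intros Hf Hg Hf0 Hg0 Hf1 Hg1.
assert (Hlim : forall (p q : R -> R) (x lf lg : R) F, Filter F ->
  filterlim f F (locally lf) -> filterlim g F (locally lg) ->
  filterlim p F (locally (p x)) -> filterlim q F (locally (q x)) ->
  filterlim (fun t => f t * p t + g t * q t) F (locally (lf * p x + lg * q x))).
{ intros p q x lf lg F HF H1 H2 H3 H4.
  apply (filterlim_comp_2 (G := locally (lf * p x)) (H := locally (lg * q x))
    (fun t => f t * p t) (fun t => g t * q t) Rplus).
  - apply (filterlim_comp_2 f p Rmult H1 H3), (filterlim_mult (K := R_AbsRing)).
  - apply (filterlim_comp_2 g q Rmult H2 H4), (filterlim_mult (K := R_AbsRing)).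
  - apply (filterlim_plus (V := R_NormedModule)). }
assert (Hcont : forall (p : R -> R) x, ex_derive p x -> 
  filterlim p (at_left x) (locally (p x)) /\ filterlim p (at_right x) (locally (p x))).
{ intros p x Hp; split; intros P HP; apply filter_le_within;
    now apply (ex_derive_continuous p). }
assert (Hconst : forall p q : R -> R,
  (forall x, ex_derive p x) -> (forall x, ex_derive q x) ->
  (forall x, 0 < x < 1 ->
     is_derive (fun t => f t * p t + g t * q t) x 0) ->
  f0 * p 0 + g0 * q 0 = f1 * p 1 + g1 * q 1).
{ intros p q Hp Hq Hd.
  apply (null_derive_limits_eq (fun t => f t * p t + g t * q t) 0 1); [lra | exact Hd | |].
  - apply Hlim; try assumption; try typeclasses eauto; now apply Hcont.
  - apply Hlim; try assumption; try typeclasses eauto; now apply Hcont. }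
assert (Df : forall x, 0 < x < 1 -> Derive (fun t : R => f t) x = g x).
{ intros x Hx; now apply is_derive_unique, Hf. }
assert (Dg : forall x, 0 < x < 1 -> Derive (fun t : R => g t) x = - k ^ 2 * f x).
{ intros x Hx; now apply is_derive_unique, Hg. }
assert (HF := Hconst (fun t => k * cos (k * t)) (fun t => - sin (k * t))).
assert (HG := Hconst (fun t => k * sin (k * t)) (fun t => cos (k * t))).
cbv beta in HF, HG; rewrite Rmult_0_r, cos_0, sin_0, !Rmult_1_r in HF, HG.
rewrite (Rmult_1_r k) in HG.
assert (HF' : f0 * k + g0 * - 0 = f1 * (k * cos k) + g1 * - sin k).
{ apply HF; intros x; try (auto_derive; easy).
  intros Hx; auto_derive.
  - split; [eexists; now apply Hf | split; [eexists; now apply Hg | easy]].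
  - rewrite (Df x Hx), (Dg x Hx); ring. }
assert (HG' : f0 * (k * 0) + g0 = f1 * (k * sin k) + g1 * cos k).
{ apply HG; intros x; try (auto_derive; easy).
  intros Hx; auto_derive.
  - split; [eexists; now apply Hf | split; [eexists; now apply Hg | easy]].
  - rewrite (Df x Hx), (Dg x Hx); ring. }
(* The conservation laws give the data at 0 in terms of the data at 1; the rotation is inverted by
   inserting sin^2 + cos^2 = 1. *)
assert (H1 := sin2_cos2 k); unfold Rsqr in H1.
split.
- replace (k * f1) with (k * f1 * (sin k * sin k + cos k * cos k)) by (rewrite H1; ring).
  replace g0 with (f1 * (k * sin k) + g1 * cos k) by (rewrite <- HG'; ring).
  replace (k * f0) with (f1 * (k * cos k) + g1 * - sin k) by (rewrite <- HF'; ring).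
  ring.
- replace g1 with (g1 * (sin k * sin k + cos k * cos k)) at 1 by (rewrite H1; ring).
  replace g0 with (f1 * (k * sin k) + g1 * cos k) by (rewrite <- HG'; ring).
  replace (k * f0) with (f1 * (k * cos k) + g1 * - sin k) by (rewrite <- HF'; ring).
  ring.
Qed.

(** The coefficients of the system are real, so real and imaginary parts evolve separately, each by
    [oscillator_transfer]. *)
Lemma Coscillator_transfer (k : R) (f g : R -> C) (f0 g0 f1 g1 : C) :
  (forall x, 0 < x < 1 -> Cis_derive f x (g x)) ->
  (forall x, 0 < x < 1 -> Cis_derive g x (RtoC (- k ^ 2) * f x)%C) ->
  filterlim f (at_right 0) (locally f0) -> filterlim g (at_right 0) (locally g0) ->
  filterlim f (at_left 1) (locally f1) -> filterlim g (at_left 1) (locally g1) ->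
  (RtoC k * f1 = RtoC k * f0 * RtoC (cos k) + g0 * RtoC (sin k))%C /\
  (g1 = g0 * RtoC (cos k) - RtoC k * f0 * RtoC (sin k))%C.
Proof.
intros Hf Hg Hf0 Hg0 Hf1 Hg1.
destruct (oscillator_transfer k (fun t => fst (f t)) (fun t => fst (g t))
  (fst f0) (fst g0) (fst f1) (fst g1)) as [A1 A2];
  try (now apply filterlim_Cfst).
{ intros x Hx; now apply Cis_derive_iff, Hf. }
{ intros x Hx; destruct (proj1 (Cis_derive_iff _ _ _) (Hg x Hx)) as [H _].
  simpl in H; replace (- k ^ 2 * fst (f x))
    with (- (k * (k * 1)) * fst (f x) - 0 * snd (f x)) by ring; exact H. }
destruct (oscillator_transfer k (fun t => snd (f t)) (fun t => snd (g t))
  (snd f0) (snd g0) (snd f1) (snd g1)) as [B1 B2];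
  try (now apply filterlim_Csnd).
{ intros x Hx; now apply Cis_derive_iff, Hf. }
{ intros x Hx; destruct (proj1 (Cis_derive_iff _ _ _) (Hg x Hx)) as [_ H].
  simpl in H; replace (- k ^ 2 * snd (f x))
    with (- (k * (k * 1)) * snd (f x) + 0 * fst (f x)) by ring; exact H. }
destruct f0, g0, f1, g1; unfold Cplus, Cminus, Cmult, Copp, RtoC; simpl in *.
split; apply injective_projections; simpl; lra.
Qed.

(** * The linear system for the two amplitudes *)

Lemma Ci_sqr : (Ci * Ci = - (1))%C.
Proof. apply injective_projections; simpl; ring. Qed.

(** The denominator common to both amplitudes once the tangent is cleared. Up to the factor [Ci] it
    is the determinant of the interface system in the unknowns R_0 and T_0. *)
Definition amp_den (eta k zeta : R) : C :=
  (- Ci * RtoC (zeta ^ 2 + eta ^ 2 * k ^ 2) * RtoC (sin k)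
   + RtoC (2 * zeta * eta * k * cos k))%C.

(** The real part is a positive multiple of cos k and the imaginary part a negative multiple of sin
    k, and these two never vanish together. *)
Lemma amp_den_neq_0 (eta k zeta : R) :
  0 < eta -> 0 < k -> 0 < zeta -> amp_den eta k zeta <> 0%C.
Proof.
intros He Hk Hz H; injection H; intros Him Hre; simpl in Him, Hre.
assert (Hp := Rmult_lt_0_compat _ _ (Rmult_lt_0_compat _ _ Hz He) Hk).
assert (Hp2 := Rmult_lt_0_compat _ _ Hz Hz).
assert (Hp3 := Rle_0_sqr (eta * k)); unfold Rsqr in Hp3.
assert (Hc : cos k = 0).
{ apply (Rmult_eq_reg_l (2 * zeta * eta * k)); lra. }
assert (Hs : sin k = 0).
{ apply (Rmult_eq_reg_l (zeta * zeta + eta * k * (eta * k))); lra. }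
generalize (sin2_cos2 k); rewrite Hs, Hc; unfold Rsqr; lra.
Qed.

(** Multiplying numerator and denominator by cos k turns the tangent form into the sine form, so
    both cases of [refl_amp] share one expression. *)
Lemma refl_amp_sin (eta k zeta : R) (I0 : C) :
  0 < eta -> 0 < k -> 0 < zeta ->
  refl_amp eta k zeta I0 =
  (Ci * RtoC (- zeta ^ 2 + eta ^ 2 * k ^ 2) * RtoC (sin k)
   / amp_den eta k zeta * I0)%C.
Proof.
intros He Hk Hz.
assert (HD := amp_den_neq_0 _ _ _ He Hk Hz).
unfold refl_amp; destruct (Req_EM_T (cos k) 0) as [_ | Hc]; [reflexivity |].
assert (HcC : RtoC (cos k) <> 0%C) by (now intros [= H]).
assert (Ht : (RtoC (sin k) = RtoC (tan k) * RtoC (cos k))%C).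
{ rewrite <- RtoC_mult; f_equal; unfold tan; field; exact Hc. }
set (D' := (- Ci * RtoC (zeta ^ 2 + eta ^ 2 * k ^ 2) * RtoC (tan k)
        + RtoC (2 * zeta * eta * k))%C).
assert (HDD : amp_den eta k zeta = (D' * RtoC (cos k))%C).
{ unfold amp_den, D'; rewrite Ht, (RtoC_mult _ (cos k)); ring. }
rewrite HDD in HD |- *; rewrite Ht.
assert (HD' : D' <> 0%C) by (intros E; apply HD; rewrite E; ring).
field; now split.
Qed.

Lemma Ceq_of_minus (x y : C) : (x - y = 0)%C -> x = y.
Proof. intros H; replace x with (x - y + y)%C by ring; rewrite H; ring. Qed.

(* The four interface conditions, after the transfer through the layer. *)
Lemma interface_system (eta k zeta : R) (I0 Rf T : C) :
  0 < eta -> 0 < k -> 0 < zeta ->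
  ((RtoC k * (RtoC eta * (I0 + Rf))
      = RtoC k * (RtoC eta * T) * RtoC (cos k) + - Ci * RtoC zeta * T * RtoC (sin k))%C /\
   (Ci * RtoC zeta * (Rf - I0)
      = - Ci * RtoC zeta * T * RtoC (cos k) - RtoC k * (RtoC eta * T) * RtoC (sin k))%C)
  <-> (Rf = refl_amp eta k zeta I0 /\ T = trans_amp eta k zeta I0).
Proof.
intros He Hk Hz.
assert (HD := amp_den_neq_0 _ _ _ He Hk Hz).
rewrite (refl_amp_sin _ _ _ _ He Hk Hz); unfold trans_amp; fold (amp_den eta k zeta).
assert (HDe : amp_den eta k zeta =
  (- Ci * (RtoC zeta * RtoC zeta + RtoC eta * RtoC eta * (RtoC k * RtoC k)) * RtoC (sin k)
   + 2 * RtoC zeta * RtoC eta * RtoC k * RtoC (cos k))%C).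
{ unfold amp_den; simpl pow.
  rewrite !Rmult_1_r, RtoC_plus, !RtoC_mult; ring. }
replace (RtoC (- zeta ^ 2 + eta ^ 2 * k ^ 2)) with
  (RtoC eta * RtoC eta * (RtoC k * RtoC k) - RtoC zeta * RtoC zeta)%C
  by (simpl pow; rewrite !Rmult_1_r, RtoC_plus, RtoC_opp, !RtoC_mult; ring).
rewrite !(RtoC_mult _ k), !(RtoC_mult _ eta), !(RtoC_mult _ zeta).
set (D := amp_den eta k zeta) in *.
assert (HeC : RtoC eta <> 0%C) by (intros [= H]; lra).
assert (HkC : RtoC k <> 0%C) by (intros [= H]; lra).
assert (HzC : RtoC zeta <> 0%C) by (intros [= H]; lra).
revert HDe HeC HkC HzC.
(* From here the identities are polynomial in independent letters; what remains to be used is i^2 =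
   -1, the expression of [D], and the non-vanishing of the denominators. *)
generalize (RtoC eta) (RtoC k) (RtoC zeta) (RtoC (cos k)) (RtoC (sin k)).
intros N K Z c s HDe HN HK HZ.
assert (H2 : (2 <> 0)%C) by (intros [= H]; lra).
assert (Hi := Ci_sqr).
assert (HiC : Ci <> 0%C) by (intros [= H]; lra).
split.
- intros [E1 E2].
  (* Elimination of [Rf]: i zeta times the first equation minus k eta times the second, all
     multiplied by i. *)
  assert (HT : (D * T = 2 * Z * N * K * I0)%C).
  { rewrite HDe; apply Ceq_of_minus.
    transitivity (Ci * (Ci * Z * (K * (N * (I0 + Rf)) - (K * (N * T) * c + - Ci * Z * T * s))
      - K * N * (Ci * Z * (Rf - I0) - (- Ci * Z * T * c - K * (N * T) * s))))%C.
    - ring [Hi].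
    - rewrite E1, E2; ring. }
  (* The sum of the same two multiples cancels the [I0] terms; the factor -i normalises the
     coefficient of [Rf]. *)
  assert (HR : (2 * Z * N * K * Rf = Ci * (N * N * (K * K) - Z * Z) * s * T)%C).
  { apply Ceq_of_minus.
    transitivity (- Ci * (Ci * Z * (K * (N * (I0 + Rf)) - (K * (N * T) * c + - Ci * Z * T * s))
      + K * N * (Ci * Z * (Rf - I0) - (- Ci * Z * T * c - K * (N * T) * s))))%C.
    - ring [Hi].
    - rewrite E1, E2; ring. }
  assert (ET : (T = 2 * Z * N * K / D * I0)%C).
  { replace T with (D * T / D)%C by (field; exact HD); rewrite HT; field; exact HD. }
  split; [|exact ET].
  replace Rf with (2 * Z * N * K * Rf / (2 * Z * N * K))%C
    by (field; repeat split; assumption).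
  rewrite HR, ET; field; repeat split; assumption.
- intros [-> ->]; split; apply Ceq_of_minus.
  (* After substitution, the defect of each equation is a multiple of [D] minus its explicit
     expression, which is 0 by [HDe]. *)
  + transitivity ((K * N * I0 * (D - (- Ci * (Z * Z + N * N * (K * K)) * s
      + 2 * Z * N * K * c))) / D)%C.
    * field [Hi]; exact HD.
    * rewrite <- HDe; field; exact HD.
  + transitivity ((- Ci * Z * I0 * (D - (- Ci * (Z * Z + N * N * (K * K)) * s
      + 2 * Z * N * K * c))) / D)%C.
    * field [Hi]; exact HD.
    * rewrite <- HDe; field; exact HD.
Qed.

(** * The coefficients in each region, and separated solutions of the equation *)

Lemma in_layer_true (x : R) : 0 < x < 1 -> in_layer x = true.
Proof.
intros H; unfold in_layer.
destruct (Rlt_dec 0 x); [destruct (Rlt_dec x 1)|]; (reflexivity || lra).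
Qed.

Lemma in_layer_false (x : R) : x < 0 \/ 1 < x -> in_layer x = false.
Proof.
intros H; unfold in_layer.
destruct (Rlt_dec 0 x); [destruct (Rlt_dec x 1)|]; (reflexivity || lra).
Qed.

Lemma flux_layer (eta : R) (u : R -> R -> C) (x1 x2 : R) :
  0 < eta -> in_layer x2 = true ->
  flux eta u 0 x1 x2 = (RtoC 0 * partial1 u x1 x2)%C /\
  flux eta u 1 x1 x2 = (RtoC eta * partial2 u x1 x2)%C.
Proof.
intros He H; unfold flux, tau; rewrite H; cbn.
assert (E : / (1 / eta) = eta) by (field; lra).
rewrite E; split; ring.
Qed.

Lemma flux_outside (eta : R) (u : R -> R -> C) (x1 x2 : R) :
  in_layer x2 = false ->
  flux eta u 0 x1 x2 = (RtoC 1 * partial1 u x1 x2)%C /\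
  flux eta u 1 x1 x2 = (RtoC 1 * partial2 u x1 x2)%C.
Proof.
intros H; unfold flux, tau; rewrite H; cbn.
rewrite Rinv_1; split; ring.
Qed.

Lemma locally_lt (x b : R) : x < b -> locally x (fun y => y < b).
Proof. apply (open_lt b x). Qed.

Lemma locally_gt (x a : R) : a < x -> locally x (fun y => a < y).
Proof. apply (open_gt a x). Qed.

Lemma locally_between (x a b : R) : a < x < b -> locally x (fun y => a < y < b).
Proof.
intros [Ha Hb]; apply filter_and; [now apply locally_gt | now apply locally_lt].
Qed.

(** One computation serves all three regions: [alpha] and [beta] are the diagonal entries of 1/tau,
    and [beta] is also the value of [mu]. Outside the layer they are 1, 1 with [m] = zeta, and the
    dispersion relation reads kappa^2 + zeta^2 = k^2; inside they are 0, eta with [m] = k, and it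
    holds for every kappa. *)
Lemma solves_at_separated (eta k kappa m d alpha beta : R) (a b : C)
  (u : R -> R -> C) (x1 x2 : R) :
  locally x2 (fun y => forall s, u s y = (expi (kappa * s) * harmonic a b m (y - d))%C) ->
  locally x2 (fun y => forall s,
    flux eta u 0 s y = (RtoC alpha * partial1 u s y)%C /\
    flux eta u 1 s y = (RtoC beta * partial2 u s y)%C) ->
  mu eta x2 = beta -> alpha * kappa ^ 2 + beta * m ^ 2 = k ^ 2 * beta ->
  solves_at eta k u x1 x2.
Proof.
intros Hu Hflux Hmu Hdisp.
assert (Hu1 : locally x2 (fun y => forall s, Cis_derive (fun t => u t y) s
   (Ci * RtoC kappa * expi (kappa * s) * harmonic a b m (y - d))%C)).
{ revert Hu; apply filter_imp; intros y Hy s.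
  apply Cis_derive_ext_loc with (fun t => (expi (kappa * t) * harmonic a b m (y - d))%C).
  - apply filter_forall; intros t; now rewrite Hy.
  - apply Cis_derive_mult_r, Cis_derive_expi. }
assert (Hu2 : locally x2 (fun y => forall s, Cis_derive (fun t => u s t) y
   (expi (kappa * s) * harmonic (RtoC m * b) (- RtoC m * a) m (y - d))%C)).
(* The flux has to be differentiated once more, so the first derivative is needed at all nearby
   heights, and at each of them the formula for [u] must hold in a neighbourhood. *)
{ apply locally_locally in Hu; revert Hu; apply filter_imp; intros y Hy s.
  apply Cis_derive_ext_loc with (fun t => (expi (kappa * s) * harmonic a b m (t - d))%C).
  - revert Hy; apply filter_imp; intros t Ht; now rewrite Ht.
  - apply Cis_derive_mult_l, Cis_derive_harmonic. }
assert (Hf0 : Cis_derive (fun s => flux eta u 0 s x2) x1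
  (RtoC alpha * (Ci * RtoC kappa * (Ci * RtoC kappa * expi (kappa * x1))
     * harmonic a b m (x2 - d)))%C).
{ apply Cis_derive_ext_loc with (fun t =>
    (RtoC alpha * (Ci * RtoC kappa * expi (kappa * t) * harmonic a b m (x2 - d)))%C).
  - apply filter_forall; intros t.
    rewrite (proj1 (locally_singleton _ _ Hflux t)).
    unfold partial1; now rewrite (Cis_derive_CDerive _ _ _ (locally_singleton _ _ Hu1 t)).
  - apply Cis_derive_mult_l, Cis_derive_mult_r, Cis_derive_mult_l, Cis_derive_expi. }
assert (Hf1 : Cis_derive (fun s => flux eta u 1 x1 s) x2
  (RtoC beta * (expi (kappa * x1)
     * harmonic (RtoC m * (- RtoC m * a)) (- RtoC m * (RtoC m * b)) m (x2 - d)))%C).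
{ apply Cis_derive_ext_loc with (fun t =>
    (RtoC beta * (expi (kappa * x1) * harmonic (RtoC m * b) (- RtoC m * a) m (t - d)))%C).
  - generalize (filter_and _ _ Hflux Hu2); apply filter_imp; intros y [Hy1 Hy2].
    rewrite (proj2 (Hy1 x1)).
    unfold partial2; now rewrite (Cis_derive_CDerive _ _ _ (Hy2 x1)).
  - apply Cis_derive_mult_l, Cis_derive_mult_l, Cis_derive_harmonic. }
repeat split.
- eexists; apply (locally_singleton _ _ Hu1).
- eexists; apply (locally_singleton _ _ Hu2).
- eexists; exact Hf0.
- eexists; exact Hf1.
- unfold partial1 at 1, partial2 at 1.
  rewrite (Cis_derive_CDerive _ _ _ Hf0), (Cis_derive_CDerive _ _ _ Hf1),
    (locally_singleton _ _ Hu), Hmu, <- Hdisp; unfold harmonic.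
  simpl pow; rewrite !Rmult_1_r, RtoC_plus, !RtoC_mult.
  assert (Hi := Ci_sqr); ring [Hi].
Qed.

(** * Matching across an interface *)

(** [F] and [G] are the formulas valid on either side, extended smoothly across [a]; their
    continuity turns the matching of limits into the equation [F a = G a]. *)
Lemma match_at_intro (a : R) (f g F G : R -> C) (dF dG : C) :
  at_left a (fun t => F t = f t) -> at_right a (fun t => G t = g t) ->
  Cis_derive F a dF -> Cis_derive G a dG -> F a = G a -> match_at a f g.
Proof.
intros Hf Hg HF HG E; exists (F a); split.
- apply (filterlim_ext_loc _ _ Hf), (Cis_derive_at_left _ _ _ HF).
- rewrite E; apply (filterlim_ext_loc _ _ Hg), (Cis_derive_at_right _ _ _ HG).
Qed.

(** Used with the explicit exterior field on the left: its limit is the value of the smooth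
    extension [F], and uniqueness of limits hands this value to the unknown field on the right. *)
Lemma match_at_right_lim (a : R) (f g F : R -> C) (dF : C) :
  match_at a f g -> at_left a (fun t => F t = f t) -> Cis_derive F a dF ->
  filterlim g (at_right a) (locally (F a)).
Proof.
intros [l [Hf Hg]] Hl HF.
replace (F a) with l; [exact Hg |].
apply (C_filterlim_unique (at_left a) f); [typeclasses eauto | exact Hf |].
apply (filterlim_ext_loc _ _ Hl), (Cis_derive_at_left _ _ _ HF).
Qed.

Lemma match_at_left_lim (a : R) (f g G : R -> C) (dG : C) :
  match_at a f g -> at_right a (fun t => G t = g t) -> Cis_derive G a dG ->
  filterlim f (at_left a) (locally (G a)).
Proof.
intros [l [Hf Hg]] Hl HG.
replace (G a) with l; [exact Hf |].
apply (C_filterlim_unique (at_right a) g); [typeclasses eauto | exact Hg |].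
apply (filterlim_ext_loc _ _ Hl), (Cis_derive_at_right _ _ _ HG).
Qed.

Lemma at_left_gt (a b : R) (P : R -> Prop) :
  a < b -> (forall y, a < y < b -> P y) -> at_left b P.
Proof.
intros Hab H; apply (filter_imp (F := locally b) (fun y => a < y)).
- intros y Hy Hyb; now apply H.
- now apply locally_gt.
Qed.

Lemma at_right_lt (a b : R) (P : R -> Prop) :
  a < b -> (forall y, a < y < b -> P y) -> at_right a P.
Proof.
intros Hab H; apply (filter_imp (F := locally a) (fun y => y < b)).
- intros y Hy Hay; now apply H.
- now apply locally_lt.
Qed.

(** * Existence: plane waves as harmonics and the explicit field *)

Lemma downgoing_harmonic (T : C) (m t : R) :
  (T * expi (- (m * t)))%C = harmonic T (- Ci * T) m t.
Proof. rewrite expi_opp_harmonic; unfold harmonic; ring. Qed.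

Lemma standing_harmonic (A B : C) (m t : R) :
  (A * expi (- (m * t)) + B * expi (m * t))%C = harmonic (A + B) (Ci * (B - A)) m t.
Proof. rewrite expi_opp_harmonic, expi_harmonic; unfold harmonic; ring. Qed.

Lemma partial2_separated (u : R -> R -> C) (w a b : C) (m d x1 x2 : R) :
  locally x2 (fun y => (w * harmonic a b m (y - d))%C = u x1 y) ->
  partial2 u x1 x2 = (w * harmonic (RtoC m * b) (- RtoC m * a) m (x2 - d))%C.
Proof.
intros Hu; apply Cis_derive_CDerive.
apply (Cis_derive_ext_loc _ _ _ _ Hu), Cis_derive_mult_l, Cis_derive_harmonic.
Qed.

(** The field is written down with the claimed amplitudes. The conditions at 0 hold by the choice of
    the layer coefficients; those at 1 are [interface_system] read from right to left. *)
Lemma total_field_exists (eta k kappa zeta : R) (I0 : C) :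
  0 < eta -> 0 < k -> 0 < zeta -> kappa ^ 2 + zeta ^ 2 = k ^ 2 ->
  exists u, total_field eta k kappa zeta (incident kappa zeta I0) u.
Proof.
intros He Hk Hz Hdisp.
destruct (proj2 (interface_system eta k zeta I0 _ _ He Hk Hz) (conj eq_refl eq_refl))
  as [E1 E2].
set (Rf := refl_amp eta k zeta I0) in *; set (T := trans_amp eta k zeta I0) in *.
assert (HeC : RtoC eta <> 0%C) by (intros [= H]; lra).
assert (HkC : RtoC k <> 0%C) by (intros [= H]; lra).
(* Continuity of the flux at 0 forces eta k [B] = -i zeta [T], while continuity of the value makes
   [T] the cosine coefficient in the layer. *)
set (B := (- Ci * RtoC zeta * T / (RtoC eta * RtoC k))%C).
set (phi := fun y => if Rle_dec y 0 then harmonic T (- Ci * T) zeta (y - 0)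
  else if Rlt_dec y 1 then harmonic T B k (y - 0)
  else harmonic (I0 + Rf) (Ci * (Rf - I0)) zeta (y - 1)).
assert (Hlow : forall y, y < 0 -> phi y = harmonic T (- Ci * T) zeta (y - 0)).
{ intros y Hy; unfold phi; destruct (Rle_dec y 0); [reflexivity | lra]. }
assert (Hmid : forall y, 0 < y < 1 -> phi y = harmonic T B k (y - 0)).
{ intros y Hy; unfold phi; destruct (Rle_dec y 0); [lra |].
  destruct (Rlt_dec y 1); [reflexivity | lra]. }
assert (Hup : forall y, 1 < y ->
  phi y = harmonic (I0 + Rf) (Ci * (Rf - I0)) zeta (y - 1)).
{ intros y Hy; unfold phi; destruct (Rle_dec y 0); [lra |].
  destruct (Rlt_dec y 1); [lra | reflexivity]. }
clearbody phi.
set (u := fun x1 x2 => (expi (kappa * x1) * phi x2)%C).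
assert (Ulow : forall x1 y, y < 0 ->
  u x1 y = (expi (kappa * x1) * harmonic T (- Ci * T) zeta (y - 0))%C).
{ intros x1 y Hy; unfold u; now rewrite Hlow. }
assert (Umid : forall x1 y, 0 < y < 1 ->
  u x1 y = (expi (kappa * x1) * harmonic T B k (y - 0))%C).
{ intros x1 y Hy; unfold u; now rewrite Hmid. }
assert (Uup : forall x1 y, 1 < y -> u x1 y =
  (expi (kappa * x1) * harmonic (I0 + Rf) (Ci * (Rf - I0)) zeta (y - 1))%C).
{ intros x1 y Hy; unfold u; now rewrite Hup. }
assert (Dlow : forall x1 y, y < 0 -> partial2 u x1 y =
  (expi (kappa * x1) * harmonic (RtoC zeta * (- Ci * T)) (- RtoC zeta * T) zeta (y - 0))%C).
{ intros x1 y Hy; apply partial2_separated.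
  generalize (locally_lt y 0 Hy); apply filter_imp; intros t Ht.
  symmetry; now apply Ulow. }
assert (Dmid : forall x1 y, 0 < y < 1 -> partial2 u x1 y =
  (expi (kappa * x1) * harmonic (RtoC k * B) (- RtoC k * T) k (y - 0))%C).
{ intros x1 y Hy; apply partial2_separated.
  generalize (locally_between y 0 1 Hy); apply filter_imp; intros t Ht.
  symmetry; now apply Umid. }
assert (Dup : forall x1 y, 1 < y -> partial2 u x1 y =
  (expi (kappa * x1) * harmonic (RtoC zeta * (Ci * (Rf - I0)))
     (- RtoC zeta * (I0 + Rf)) zeta (y - 1))%C).
{ intros x1 y Hy; apply partial2_separated.
  generalize (locally_gt y 1 Hy); apply filter_imp; intros t Ht.
  symmetry; now apply Uup. }
exists u; split.
- intros x1 x2 H0 H1.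
  destruct (Rlt_dec x2 0) as [Hlt0 | Hge0]; [| destruct (Rlt_dec x2 1) as [Hlt1 | Hge1]].
  + apply (solves_at_separated eta k kappa zeta 0 1 1 T (- Ci * T)).
    * generalize (locally_lt x2 0 Hlt0); apply filter_imp; intros y Hy s.
      now apply Ulow.
    * generalize (locally_lt x2 0 Hlt0); apply filter_imp; intros y Hy s.
      apply flux_outside, in_layer_false; now left.
    * unfold mu; rewrite in_layer_false; [reflexivity | now left].
    * rewrite !Rmult_1_l, Rmult_1_r; exact Hdisp.
  + assert (Hin : 0 < x2 < 1) by lra.
    apply (solves_at_separated eta k kappa k 0 0 eta T B).
    * generalize (locally_between x2 0 1 Hin); apply filter_imp; intros y Hy s.
      now apply Umid.
    * generalize (locally_between x2 0 1 Hin); apply filter_imp; intros y Hy s.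
      now apply flux_layer; [| apply in_layer_true].
    * unfold mu; now rewrite in_layer_true.
    * ring.
  + assert (Hgt1 : 1 < x2) by lra.
    apply (solves_at_separated eta k kappa zeta 1 1 1 (I0 + Rf) (Ci * (Rf - I0))).
    * generalize (locally_gt x2 1 Hgt1); apply filter_imp; intros y Hy s.
      now apply Uup.
    * generalize (locally_gt x2 1 Hgt1); apply filter_imp; intros y Hy s.
      apply flux_outside, in_layer_false; now right.
    * unfold mu; rewrite in_layer_false; [reflexivity | now right].
    * rewrite !Rmult_1_l, Rmult_1_r; exact Hdisp.
- intros x1; eapply match_at_intro.
  + apply (at_left_gt (-1)); [lra |]; intros y Hy.
    symmetry; apply Ulow; lra.
  + apply (at_right_lt 0 1); [lra |]; intros y Hy.
    symmetry; apply Umid; lra.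
  + apply Cis_derive_mult_l, Cis_derive_harmonic.
  + apply Cis_derive_mult_l, Cis_derive_harmonic.
  + cbv beta; now rewrite !harmonic_0.
- intros x1; eapply match_at_intro.
  + apply (at_left_gt (-1)); [lra |]; intros y Hy.
    symmetry; apply Dlow; lra.
  + apply (at_right_lt 0 1); [lra |]; intros y Hy.
    symmetry; apply (f_equal (Cmult (RtoC eta))), Dmid; lra.
  + apply Cis_derive_mult_l, Cis_derive_harmonic.
  + apply Cis_derive_mult_l, Cis_derive_mult_l, Cis_derive_harmonic.
  + cbv beta; rewrite !harmonic_0; unfold B; field; now split.
- intros x1; eapply match_at_intro.
  + apply (at_left_gt 0); [lra |]; intros y Hy.
    symmetry; apply Umid; lra.
  + apply (at_right_lt 1 2); [lra |]; intros y Hy.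
    symmetry; apply Uup; lra.
  + apply Cis_derive_mult_l, Cis_derive_harmonic.
  + apply Cis_derive_mult_l, Cis_derive_harmonic.
  + cbv beta; rewrite harmonic_0; unfold harmonic, B.
    rewrite Rminus_0_r, Rmult_1_r; f_equal.
    (* Continuity of the value at 1 is the first interface equation divided by k eta. *)
    transitivity ((RtoC k * (RtoC eta * (I0 + Rf))) / (RtoC k * RtoC eta))%C.
    * rewrite E1; field; now split.
    * field; now split.
- intros x1; eapply match_at_intro.
  + apply (at_left_gt 0); [lra |]; intros y Hy.
    symmetry; apply (f_equal (Cmult (RtoC eta))), Dmid; lra.
  + apply (at_right_lt 1 2); [lra |]; intros y Hy.
    symmetry; apply Dup; lra.
  + apply Cis_derive_mult_l, Cis_derive_mult_l, Cis_derive_harmonic.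
  + apply Cis_derive_mult_l, Cis_derive_harmonic.
  + cbv beta; rewrite harmonic_0; unfold harmonic, B.
    rewrite Rminus_0_r, Rmult_1_r.
    transitivity (expi (kappa * x1) * (Ci * RtoC zeta * (Rf - I0)))%C.
    * rewrite E2; field; now split.
    * ring.
- exists phi; reflexivity.
- exists Rf; intros x1 x2 Hx; unfold u, incident.
  rewrite (Hup x2 Hx), <- standing_harmonic.
  replace (kappa * x1 - zeta * (x2 - 1)) with (kappa * x1 + - (zeta * (x2 - 1))) by ring.
  rewrite !expi_plus; ring.
- exists T; intros x1 x2 Hx; unfold u.
  rewrite (Hlow x2 Hx), <- downgoing_harmonic, Rminus_0_r.
  unfold Rminus; rewrite !expi_plus; ring.
Qed.

(** * Uniqueness of the amplitudes *)

(** In the layer the horizontal flux is identically 0, so the equation becomes an ordinary one in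
    the vertical variable. The second derivative exists because [solves_at] provides
    differentiability of the vertical flux, which is eta times [partial2 u] nearby. *)
Lemma partial2_layer_derive (eta k : R) (u : R -> R -> C) (x1 x2 : R) :
  0 < eta -> 0 < x2 < 1 -> solves_at eta k u x1 x2 ->
  Cis_derive (fun y => (RtoC eta * partial2 u x1 y)%C) x2
    (RtoC (- k ^ 2) * (RtoC eta * u x1 x2))%C.
Proof.
intros He Hx [_ [_ [_ [Hf1 Heq]]]].
assert (H0 : partial1 (flux eta u 0) x1 x2 = 0%C).
{ apply Cis_derive_CDerive, Cis_derive_ext_loc with (fun _ => RtoC 0).
  - apply filter_forall; intros s.
    rewrite (proj1 (flux_layer eta u s x2 He (in_layer_true x2 Hx))); ring.
  - apply (is_derive_const (V := C_R_NormedModule)). }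
apply Cis_derive_ext_loc with (fun y => flux eta u 1 x1 y).
- generalize (locally_between x2 0 1 Hx); apply filter_imp; intros y Hy.
  apply (flux_layer eta u x1 y He (in_layer_true y Hy)).
- replace (RtoC (- k ^ 2) * (RtoC eta * u x1 x2))%C
    with (partial2 (flux eta u 1) x1 x2); [now apply Cex_derive_is_derive |].
  apply Ceq_of_minus; rewrite <- Heq, H0.
  unfold mu, mu_bar; rewrite (in_layer_true x2 Hx), RtoC_mult, RtoC_opp; ring.
Qed.

(** The exterior formulas fix the Cauchy data at 0+ and 1- through the interface conditions; the
    transfer through the layer links the two sets, which is exactly [interface_system]. *)
Lemma total_field_unique (eta k kappa zeta : R) (I0 : C) (u : R -> R -> C) (Rf T : C) :
  0 < eta -> 0 < k -> 0 < zeta ->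
  total_field eta k kappa zeta (incident kappa zeta I0) u ->
  (forall x1 x2, 1 < x2 ->
     u x1 x2 = (I0 * expi (kappa * x1 - zeta * (x2 - 1))
                + Rf * expi (kappa * x1 + zeta * (x2 - 1)))%C) ->
  (forall x1 x2, x2 < 0 -> u x1 x2 = (T * expi (kappa * x1 - zeta * x2))%C) ->
  Rf = refl_amp eta k zeta I0 /\ T = trans_amp eta k zeta I0.
Proof.
intros He Hk Hz Hu Hup Hlow.
(* The line x1 = 0 suffices, since the horizontal phase is 1 there; it is kept as an explicit factor
   to fit [partial2_separated]. *)
assert (Hup' : forall y, 1 < y ->
  (1 * harmonic (I0 + Rf) (Ci * (Rf - I0)) zeta (y - 1))%C = u 0 y).
{ intros y Hy; rewrite (Hup 0 y Hy), <- standing_harmonic.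
  rewrite Rmult_0_r, Rminus_0_l, Rplus_0_l; ring. }
assert (Hlow' : forall y, y < 0 ->
  (1 * harmonic T (- Ci * T) zeta (y - 0))%C = u 0 y).
{ intros y Hy; rewrite (Hlow 0 y Hy), <- downgoing_harmonic.
  rewrite Rmult_0_r, Rminus_0_l, Rminus_0_r; ring. }
assert (Dup : forall y, 1 < y -> (1 * harmonic (RtoC zeta * (Ci * (Rf - I0)))
     (- RtoC zeta * (I0 + Rf)) zeta (y - 1))%C = partial2 u 0 y).
{ intros y Hy; symmetry; apply partial2_separated.
  generalize (locally_gt y 1 Hy); apply filter_imp; exact Hup'. }
assert (Dlow : forall y, y < 0 -> (1 * harmonic (RtoC zeta * (- Ci * T))
     (- RtoC zeta * T) zeta (y - 0))%C = partial2 u 0 y).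
{ intros y Hy; symmetry; apply partial2_separated.
  generalize (locally_lt y 0 Hy); apply filter_imp; exact Hlow'. }
assert (L0 := match_at_right_lim _ _ _ _ _ (tf_u0 _ _ _ _ _ _ Hu 0)
  (at_left_gt (-1) 0 _ ltac:(lra) (fun y Hy => Hlow' y (proj2 Hy)))
  (Cis_derive_mult_l _ _ _ _ (Cis_derive_harmonic _ _ _ _ _))).
assert (LD0 := match_at_right_lim _ _ _ _ _ (tf_flux0 _ _ _ _ _ _ Hu 0)
  (at_left_gt (-1) 0 _ ltac:(lra) (fun y Hy => Dlow y (proj2 Hy)))
  (Cis_derive_mult_l _ _ _ _ (Cis_derive_harmonic _ _ _ _ _))).
assert (L1 := match_at_left_lim _ _ _ _ _ (tf_u1 _ _ _ _ _ _ Hu 0)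
  (at_right_lt 1 2 _ ltac:(lra) (fun y Hy => Hup' y (proj1 Hy)))
  (Cis_derive_mult_l _ _ _ _ (Cis_derive_harmonic _ _ _ _ _))).
assert (LD1 := match_at_left_lim _ _ _ _ _ (tf_flux1 _ _ _ _ _ _ Hu 0)
  (at_right_lt 1 2 _ ltac:(lra) (fun y Hy => Dup y (proj1 Hy)))
  (Cis_derive_mult_l _ _ _ _ (Cis_derive_harmonic _ _ _ _ _))).
cbv beta in L0, LD0, L1, LD1; rewrite !harmonic_0, Cmult_1_l in L0, LD0, L1, LD1.
assert (Hsol : forall x, 0 < x < 1 -> solves_at eta k u 0 x).
{ intros x Hx; apply (tf_equation _ _ _ _ _ _ Hu); lra. }
(* The transfer is applied to eta u and its derivative, so that the limits of the flux enter
   directly. *)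
destruct (Coscillator_transfer k (fun y => RtoC eta * u 0%R y)%C
  (fun y => RtoC eta * partial2 u 0 y)%C _ _ _ _
  (fun x Hx => Cis_derive_mult_l _ _ _ _ (Cex_derive_is_derive _ _ (proj1 (proj2 (Hsol x Hx)))))
  (fun x Hx => partial2_layer_derive eta k u 0 x He Hx (Hsol x Hx))
  (filterlim_Cmult_l (RtoC eta) _ _ _ L0) LD0
  (filterlim_Cmult_l (RtoC eta) _ _ _ L1) LD1) as [E1 E2].
apply interface_system; try assumption; split.
- rewrite E1; ring.
- transitivity (RtoC zeta * (Ci * (Rf - I0)))%C; [ring |].
  rewrite E2; ring.
Qed.

(** Existence accompanies the formulas so that they are not vacuous. For any total field the
    outgoing conditions supply some pair of coefficients, which [total_field_unique] identifies. *)
Theorem theorem3p3 (eta k theta kappa zeta : R) (I0 : C)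
  (Heta : 0 < eta < 1) (Hk : 0 < k) (Htheta : Rabs theta < PI / 2)
  (Hkappa : kappa = k * sin theta) (Hzeta : zeta = k * cos theta) :
  (exists u : R -> R -> C,
     total_field eta k kappa zeta (incident kappa zeta I0) u) /\
  (forall u : R -> R -> C,
     total_field eta k kappa zeta (incident kappa zeta I0) u ->
     (forall x1 x2, 1 < x2 ->
        u x1 x2 = (I0 * expi (kappa * x1 - zeta * (x2 - 1))
                   + refl_amp eta k zeta I0
                     * expi (kappa * x1 + zeta * (x2 - 1)))%C) /\
     (forall x1 x2, x2 < 0 ->
        u x1 x2 = (trans_amp eta k zeta I0
                   * expi (kappa * x1 - zeta * x2))%C)).
Proof.
destruct Heta as [He _].
assert (Hz : 0 < zeta).
{ apply Rabs_def2 in Htheta.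
  rewrite Hzeta; apply Rmult_lt_0_compat; [exact Hk | apply cos_gt_0; lra]. }
split.
- apply total_field_exists; try assumption.
  assert (H := sin2_cos2 theta); unfold Rsqr in H.
  rewrite Hkappa, Hzeta.
  replace (k ^ 2) with (k ^ 2 * (sin theta * sin theta + cos theta * cos theta))
    by (rewrite H; ring).
  ring.
- intros u Hu.
  destruct (tf_outgoing_above _ _ _ _ _ _ Hu) as [Rf HR].
  destruct (tf_outgoing_below _ _ _ _ _ _ Hu) as [T HT].
  assert (HR' : forall x1 x2, 1 < x2 ->
     u x1 x2 = (I0 * expi (kappa * x1 - zeta * (x2 - 1))
                + Rf * expi (kappa * x1 + zeta * (x2 - 1)))%C).
  { intros x1 x2 Hx; rewrite <- (HR x1 x2 Hx); unfold incident; ring. }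
  destruct (total_field_unique eta k kappa zeta I0 u Rf T He Hk Hz Hu HR' HT) as [<- <-].
  now split.
Qed.
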